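(* Let $w_1,\dots,w_n$ be positive real numbers and let $H_{\mathfrak W}=\prod_{k=1}^n\{0,w_k\}\subseteq\mathbb R^n$, equipped with the $\ell^1$ metric. Suppose that $X=\{\boldsymbol x_0=\boldsymbol 0,\boldsymbol x_1,\dots,\boldsymbol x_n\}\subseteq H_{\mathfrak W}$ is affinely independent. Then $$\det(D_X)=(-1)^n\,2^{n-1}\Bigl(\prod_{k=1}^n w_k\Bigr)\Bigl(\sum_{k=1}^n w_k\Bigr)\det(\hat B)^2 .$$
   Context: $D_X=(\|\boldsymbol x_i-\boldsymbol x_j\|_1)_{i,j=0}^n$ is the distance matrix of $X$. With $W=\mathrm{diag}(w_1,\dots,w_n)$, put $\hat{\boldsymbol x}_i=W^{-1}\boldsymbol x_i\in\{0,1\}^n$; $\hat B$ is the $n\times n$ matrix whose $i$th row is $\hat{\boldsymbol x}_i$, $1\le i\le n$. *)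

(* Defs.v *)
From mathcomp Require Import all_boot all_order all_algebra reals.
Set Implicit Arguments.
Unset Strict Implicit.
Unset Printing Implicit Defensive.
Import Order.TTheory GRing.Theory Num.Theory.
Local Open Scope ring_scope.

Definition l1norm (R : realType) (n : nat) (v : 'cV[R]_n) : R :=
  \sum_k `|v k 0|.

Definition distance_matrix (R : realType) (n m : nat)
    (x : 'I_m -> 'cV[R]_n) : 'M[R]_m :=
  \matrix_(i, j) l1norm (x i - x j).

Definition weighted_cube (R : realType) (n : nat) (w : 'cV[R]_n) :
    {pred 'cV[R]_n} :=
  [pred x : 'cV[R]_n | [forall k, x k 0 \in [:: 0; w k 0]]].

Definition affinely_independent (R : realType) (n m : nat)
    (x : 'I_m.+1 -> 'cV[R]_n) : bool :=
  free [seq x (lift ord0 i) - x ord0 | i <- enum 'I_m].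

Definition weight_mx (R : realType) (n : nat) (w : 'cV[R]_n) : 'M[R]_n :=
  diag_mx w^T.

Definition hat (R : realType) (n : nat) (w v : 'cV[R]_n) : 'cV[R]_n :=
  invmx (weight_mx w) *m v.

(* The rows are indexed by the points other than the base point x ord0. *)
Definition hatB (R : realType) (n m : nat) (w : 'cV[R]_n)
    (x : 'I_m.+1 -> 'cV[R]_n) : 'M[R]_(m, n) :=
  \matrix_(i < m) (hat w (x (lift ord0 i)))^T.

(* Main.v *)
Require Import Defs.
From mathcomp Require Import all_boot all_order all_algebra reals.
From mathcomp Require Import ring.
Set Implicit Arguments.
Unset Strict Implicit.
Unset Printing Implicit Defensive.
Import Order.TTheory GRing.Theory Num.Theory.
Local Open Scope ring_scope.

(** On the cube the 1-norm distance is a quadratic polynomial. If a and b are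
    0/1 numbers then |a - b| = a + b - 2ab; summed over the coordinates with
    the weights w, this says that the distance of two points x, y of the cube
    is a bilinear form evaluated at the homogeneous coordinates (1, W^-1 x)
    and (1, W^-1 y), where W = diag w. Its Gram matrix is
    Q = [0, w^T; w, -2 W] ([cube_dist_form]). Hence the distance matrix
    factors as M Q M^T, where the rows of M are the homogeneous coordinates of
    the points ([distance_matrix_factor]). With n + 1 points in dimension n
    the matrix M is square, so determinants multiply.

    As the base point is the origin, M is block triangular with diagonal
    blocks 1 and hatB, so det M = det hatB ([det_homog]). Adding half of the
    last n rows of Q to its top row makes Q block triangular, whence
    det Q = (sum w / 2) (-2)^n prod w ([det_cube_form]); the power of 2 with
    exponent n - 1, the sign, and the sum and product of the weights all come
    from there. *)

Lemma mul_weight_hat (R : realType) (n : nat) (w v : 'cV[R]_n) :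
  (forall k, 0 < w k 0) -> forall k, v k 0 = w k 0 * hat w v k 0.
Proof.
move=> w_gt0 k.
have Wu : weight_mx w \in unitmx.
  rewrite unitmxE det_diag unitfE; apply/prodf_neq0 => i _.
  by rewrite mxE gt_eqF.
by rewrite -{1}(mulKVmx Wu v) mul_diag_mx !mxE.
Qed.

Lemma hat_weighted_cube (R : realType) (n : nat) (w v : 'cV[R]_n) :
    (forall k, 0 < w k 0) -> v \in weighted_cube w ->
  forall k, hat w v k 0 = 0 \/ hat w v k 0 = 1.
Proof.
move=> w_gt0 /forallP vH k; have := vH k.
have w_neq0 : w k 0 != 0 by rewrite gt_eqF.
rewrite (mul_weight_hat v w_gt0) !inE => /orP[|/eqP e].
  by rewrite mulf_eq0 (negPf w_neq0) => /eqP; left.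
by right; apply: (mulfI w_neq0); rewrite mulr1.
Qed.

Lemma l1norm_weighted_cube (R : realType) (n : nat) (w u v : 'cV[R]_n) :
    (forall k, 0 < w k 0) -> u \in weighted_cube w -> v \in weighted_cube w ->
  l1norm (u - v) = \sum_k w k 0 *
    (hat w u k 0 + hat w v k 0 - 2 * hat w u k 0 * hat w v k 0).
Proof.
move=> w_gt0 uH vH; apply: eq_bigr => k _.
rewrite [(u - v) k 0]mxE [(- v) k 0]mxE (mul_weight_hat u w_gt0) (mul_weight_hat v w_gt0).
rewrite -mulrBr normrM gtr0_norm //; congr (_ * _).
have [-> | ->] := hat_weighted_cube w_gt0 uH k;
  have [-> | ->] := hat_weighted_cube w_gt0 vH k.
- by rewrite subrr normr0; ring.
- by rewrite sub0r normrN1; ring.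
- by rewrite subr0 normr1; ring.
- by rewrite subrr normr0; ring.
Qed.

Definition cube_form (R : realType) (n : nat) (w : 'cV[R]_n) : 'M[R]_(1 + n) :=
  block_mx 0 w^T w (- 2 *: weight_mx w).

Definition homog (R : realType) (n : nat) (w v : 'cV[R]_n) : 'rV[R]_(1 + n) :=
  row_mx 1%:M (hat w v)^T.

(** The border of the form contributes the two linear terms of
    a + b - 2ab, its diagonal block the product term. *)
Lemma cube_dist_form (R : realType) (n : nat) (w u v : 'cV[R]_n) :
    (forall k, 0 < w k 0) -> u \in weighted_cube w -> v \in weighted_cube w ->
  l1norm (u - v) = (homog w u *m cube_form w *m (homog w v)^T) 0 0.
Proof.
move=> w_gt0 uH vH; rewrite (l1norm_weighted_cube w_gt0) //.
rewrite /homog /cube_form mul_row_block tr_row_mx mul_row_col.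
rewrite mulmx0 add0r trmx1 mulmx1 mul1mx trmxK -scalemxAr mul_mx_diag.
rewrite !mxE -big_split; apply: eq_bigr => k _ /=.
by rewrite !mxE; ring.
Qed.

Lemma distance_matrix_factor (R : realType) (n m : nat) (w : 'cV[R]_n)
    (x : 'I_m -> 'cV[R]_n) :
    (forall k, 0 < w k 0) -> (forall i, x i \in weighted_cube w) ->
  let M := \matrix_i homog w (x i) in
  distance_matrix x = M *m cube_form w *m M^T.
Proof.
move=> w_gt0 xH M; apply/matrixP => i j.
rewrite mxE (cube_dist_form w_gt0) // -!(rowK (fun i => homog w (x i))) -/M.
rewrite -row_mul tr_row !mxE.
by apply: eq_bigr => k _; rewrite !mxE.
Qed.

(** Left multiplication by the unipotent matrix [1, 1/2; 0, 1] adds half of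
    each of the last n rows to the top one: this cancels w^T against the rows
    of -2 diag w, and puts half of the total weight in the corner. *)
Lemma det_cube_form (R : realType) (n : nat) (w : 'cV[R]_n) :
  \det (cube_form w) = (\sum_k w k 0) / 2 * (- 2) ^+ n * \prod_k w k 0.
Proof.
pose U : 'M[R]_(1 + n) := block_mx 1%:M (const_mx 2^-1) 0 1%:M.
have UQ : U *m cube_form w =
    block_mx ((\sum_k w k 0) / 2)%:M 0 w (- 2 *: weight_mx w).
  rewrite mulmx_block !mul0mx !mul1mx !add0r; congr block_mx.
    apply/matrixP => i j; rewrite !ord1 !mxE mulr1n mulr_suml.
    by apply: eq_bigr => k _; rewrite mxE mulrC.
  rewrite -scalemxAr mul_mx_diag; apply/matrixP => i k; rewrite !mxE ord1.
  by field.
have := det_mulmx U (cube_form w).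
rewrite UQ det_ublock !det1 !mul1r det_lblock det_scalar1 detZ det_diag => <-.
by rewrite mulrA; congr (_ * _); apply: eq_bigr => k _; rewrite mxE.
Qed.

Lemma det_homog (R : realType) (n : nat) (w : 'cV[R]_n)
    (x : 'I_n.+1 -> 'cV[R]_n) :
  x ord0 = 0 ->
  \det (\matrix_i homog w (x i)) = \det (hatB w x).
Proof.
move=> x0.
have := @det_lblock _ 1 n 1%:M (const_mx 1) (hatB w x).
rewrite det1 mul1r => <-.
congr (\det _).
apply/matrixP => i j; rewrite mxE.
case: (@split_ordP 1 n i) => i' ->; case: (@split_ordP 1 n j) => j' ->.
- by rewrite (@block_mxEul _ 1 n 1 n) row_mxEl !ord1.
- rewrite (@block_mxEur _ 1 n 1 n) row_mxEr ord1.
  have -> : @lshift 1 n 0 = ord0 by apply: val_inj.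
  by rewrite x0 /hat mulmx0 !mxE.
- by rewrite (@block_mxEdl _ 1 n 1 n) row_mxEl !ord1 !mxE.
- rewrite (@block_mxEdr _ 1 n 1 n) row_mxEr !mxE.
  by have -> : @rshift 1 n i' = lift ord0 i' by apply: val_inj.
Qed.

Theorem theorem3p5 (R : realType) (n : nat) (w : 'cV[R]_n)
    (x : 'I_n.+1 -> 'cV[R]_n)
    (w_gt0 : forall k, 0 < w k 0)
    (x0 : x ord0 = 0)
    (xH : forall i, x i \in weighted_cube w)
    (x_indep : affinely_independent x) :
  \det (distance_matrix x) =
    (-1) ^+ n * 2 ^ (n%:Z - 1) * (\prod_k w k 0) * (\sum_k w k 0) *
      \det (hatB w x) ^+ 2.
Proof.
have two_neq0 : 2 != 0 :> R by rewrite pnatr_eq0.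
rewrite (distance_matrix_factor w_gt0) // !det_mulmx det_tr det_homog //.
rewrite det_cube_form exprNn expfzDr // -exprnP -exprN1.
by ring.
Qed.
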